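(* Let $C = 1.25506$. For every integer $n \geq 1100$, the number of primes $p$ with $n < p < 2n$ is at least $$\left\lfloor \frac{n}{\log n}\left(\log 4 - C - \frac{\log 2\,\log 4}{\log(2n)}\right) \right\rfloor .$$
   Context: $\log$ denotes the natural logarithm. *)

(* Defs.v *)
From mathcomp Require Import all_boot all_order all_algebra.
From mathcomp Require Import all_classical all_reals all_analysis.

Set Implicit Arguments.
Unset Strict Implicit.
Unset Printing Implicit Defensive.

Import Order.TTheory GRing.Theory Num.Theory.

Local Open Scope ring_scope.

(* The decimal 1.25506 = 1.255 + 0.00006; ring numerals are unary, so the
   single fraction 125506 / 10 ^+ 5 overflows the stack when parsed. *)
Definition constC (R : realType) : R := 1255 / 10 ^+ 3 + 6 / 10 ^+ 5.
Arguments constC : clear implicits.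

(* Main.v *)
(* Erdos's argument for Bertrand's postulate.  A prime p divides 'C(2n, n) with
   p ^ logn p 'C(2n, n) <= 2n, at most once when p ^ 2 > 2n, and not at all when
   2n/3 < p <= n.  Since primorial m <= 4 ^ m and 4 ^ n <= 2n 'C(2n, n), the number
   P of primes between n and 2n satisfies
     4 ^ (n - 2n/3) <= (2n) ^ (s + 1 + P)   with s the integer square root of 2n.
   Put D = ln 2, L = ln n, M = ln (2n) = D + L.  The claimed lower bound is
   n (2D/M - C/L), while the above gives P >= (2/3) n D/M - (s + 1); as M > L it
   suffices that (s + 1) L <= n (C - 4D/3), which holds from n = 1100 on. *)
Require Import Defs.
From mathcomp Require Import all_boot all_order all_algebra.
From mathcomp Require Import all_classical all_reals all_analysis.
From mathcomp Require Import zify ring lra.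

Import Order.TTheory GRing.Theory Num.Theory.

Local Open Scope nat_scope.

(** * Chebyshev's bound on the primorial *)

Lemma prime_prod_dvdn (s : seq nat) (m : nat) :
  uniq s -> all prime s -> all (dvdn^~ m) s -> \prod_(p <- s) p %| m.
Proof.
elim: s => [|p s IHs] /=; first by rewrite big_nil dvd1n.
move=> /andP[ps us] /andP[pp sp] /andP[pm sm].
rewrite big_cons Gauss_dvd ?pm ?IHs //.
rewrite big_seq; apply: (big_ind (coprime p)) => [|x y|q qs]; first exact: coprimen1.
  by rewrite coprimeMr => -> ->.
rewrite prime_coprime // dvdn_prime2 ?(allP sp q) //.
by apply: contraNN ps => /eqP->.
Qed.

Lemma prime_dvdn_fact p n : prime p -> (p %| n`!) = (p <= n).
Proof.
move=> pp; apply/idP/idP => [|pn]; last by rewrite dvdn_fact ?prime_gt0.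
elim: n => [|n IHn]; first by rewrite Euclid_dvd1.
rewrite factS Euclid_dvdM // => /orP[/dvdn_leq|/IHn]; lia.
Qed.

(** Two equal middle coefficients both occur in the expansion of (1 + 1) ^ (2m + 1) = 2 * 4 ^ m. *)
Lemma central_bin_odd_leq m : 'C(m.*2.+1, m) <= 4 ^ m.
Proof.
have Csym : 'C(m.*2.+1, m.+1) = 'C(m.*2.+1, m).
  by rewrite -(@bin_sub _ m); [congr 'C(_, _); lia | lia].
suff: 'C(m.*2.+1, m.+1) + 'C(m.*2.+1, m) <= 2 ^ m.*2.+1.
  by rewrite Csym expnS -[m.*2]mul2n expnM addnn -mul2n leq_pmul2l.
rewrite -[2 ^ _]/((1 + 1) ^ _) expnDn.
rewrite (bigD1 (inord m.+1)) //= (bigD1 (inord m)) /=; last first.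
  by rewrite -val_eqE /= !inordK //; lia.
by rewrite !exp1n !muln1 !inordK; lia.
Qed.

Definition primorial (n : nat) := \prod_(0 <= p < n.+1 | prime p) p.

(** Strong induction. An even n > 2 is not prime, so n - 1 gives the bound. For n = 2m + 1, the
    primes from m + 2 to n divide n! but neither m! nor (m + 1)!, so their product divides 'C(2m +
    1, m) <= 4 ^ m; the smaller primes contribute at most 4 ^ (m + 1). *)
Lemma primorial_leq n : primorial n <= 4 ^ n.
Proof.
elim/ltn_ind: n => n IHn.
have [n2|n2] := leqP n 2.
  by case: n n2 {IHn} => [|[|[|]]] // _;
    rewrite /primorial big_mkcond; do ?rewrite big_nat_recr //=; rewrite big_geq.
have [m En] : exists m, n = m.*2 \/ n = m.*2.+1 by exists n./2; lia.
case: En => En.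
  rewrite /primorial big_mkcond big_nat_recr //= -big_mkcond.
  have -> : prime n = false.
    by apply/negbTE/negP => /even_prime []; lia.
  rewrite muln1.
  have := IHn n.-1; rewrite /primorial prednK; last lia.
  by move=> /(_ ltac:(lia)) /leq_trans; apply; rewrite leq_exp2l //; lia.
rewrite /primorial (@big_cat_nat _ _ _ m.+2) //=; last lia.
rewrite (_ : n = m.+1 + m); last lia.
rewrite expnD leq_mul //; first by apply: IHn; lia.
apply: leq_trans (central_bin_odd_leq m).
apply: dvdn_leq; first by rewrite bin_gt0; lia.
rewrite -big_filter; apply: prime_prod_dvdn.
- by rewrite filter_uniq // iota_uniq.
- exact: filter_all.
apply/allP => p; rewrite mem_filter mem_index_iota => /and3P[pp lp pu].
have: p %| (m.*2.+1)`! by rewrite prime_dvdn_fact //; lia.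
rewrite -(@bin_fact _ m); last lia.
rewrite !Euclid_dvdM // !prime_dvdn_fact //; lia.
Qed.

(** * Size and prime factorization of the central binomial coefficient *)

Lemma central_bin_geq n : 0 < n -> 4 ^ n <= n.*2 * 'C(n.*2, n).
Proof.
case: n => // n _; elim: n => // n IHn.
have E : n.+2 * 'C(n.+2.*2, n.+2) = (n.+1.*2.+1).*2 * 'C(n.+1.*2, n.+1).
  have := mul_bin_diag n.+2.*2 n.+1.
  have := mul_bin_down n.+2.*2.-1 n.+1.
  rewrite !doubleS /=.
  move: 'C(_, _) => a; move: 'C(_, _) => b; move: 'C(_, _) => c.
  rewrite -!muln2; nia.
(* With k = n + 1, [E] turns 2(k + 1) 'C(2k + 2, k + 1) into 4(2k + 1) 'C(2k, k), which is at least
   4 times 2k 'C(2k, k). *)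
rewrite expnS -doubleMl E; nia.
Qed.

(* Legendre's formula, term by term. *)
Lemma logn_central_bin_leq p n (e : nat -> nat) : prime p ->
    (forall k, 0 < k -> n.*2 %/ p ^ k <= (n %/ p ^ k).*2 + e k) ->
  logn p 'C(n.*2, n) <= \sum_(1 <= k < n.*2.+1) e k.
Proof.
move=> pp le_e; have n_le : n <= n.*2 by rewrite -addnn leq_addl.
have /(congr1 (logn p)) : 'C(n.*2, n) * (n`! * n`!) = n.*2`!.
  by rewrite -[RHS](@bin_fact _ n) -addnn ?addnK ?leq_addl.
rewrite !lognM ?muln_gt0 ?fact_gt0 ?bin_gt0 //.
(* The sum for n! is extended to the range of the one for (2n)!; the added terms vanish because n <
   p ^ k. *)
have -> : logn p n`! = \sum_(1 <= k < n.*2.+1) n %/ p ^ k.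
  rewrite logn_fact // [RHS](@big_cat_nat _ _ _ n.+1) //=.
  rewrite [X in _ = _ + X]big_nat [X in _ = _ + X]big1 ?addn0 // => k /andP[nk _].
  by rewrite divn_small // (leq_ltn_trans _ (ltn_expl k (prime_gt1 pp))) // ltnW.
rewrite logn_fact // addnn -[X in _ + X = _]mul2n big_distrr /= => E.
rewrite -(leq_add2r (\sum_(1 <= k < n.*2.+1) 2 * (n %/ p ^ k))) E -big_split /=.
rewrite !big_nat; apply: leq_sum => k /andP[k0 _].
by rewrite addnC mul2n le_e.
Qed.

(** Each Legendre term is at most 1, and it is 0 once p ^ k > 2n, so the exponent is at most
    [trunc_log p n.*2]. *)
Lemma expn_logn_central_bin_leq p n : prime p -> 0 < n ->
  p ^ logn p 'C(n.*2, n) <= n.*2.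
Proof.
move=> pp n0; have p1 := prime_gt1 pp.
apply: (@leq_trans (p ^ trunc_log p n.*2)); last by rewrite trunc_logP // double_gt0.
rewrite leq_exp2l //.
apply: leq_trans (@logn_central_bin_leq p n (fun k => k <= trunc_log p n.*2) pp _) _.
  move=> k k0; have pk : 0 < p ^ k by rewrite expn_gt0 prime_gt0.
  have [/(trunc_log_max p1) -> | /divn_small -> //] := leqP (p ^ k) n.*2.
  by rewrite -ltnS ltn_divLR //; have := ltn_ceil n pk; lia.
set t := trunc_log _ _; suff -> : \sum_(1 <= k < n.*2.+1) (k <= t) = minn n.*2 t.
  exact: geq_minr.
elim: n.*2 => [|m IHm]; first by rewrite big_geq // min0n.
by rewrite big_nat_recr // IHm /=; case: leqP; lia.
Qed.

(** All Legendre terms vanish: for k = 1 the quotients of 2n and n are 2 and 1, and for k >= 2 they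
    are 0, as p >= 3 gives p ^ 2 >= 3p > 2n. *)
Lemma logn_central_bin_medium p n : prime p -> 4 < n -> p <= n -> n.*2 < 3 * p ->
  logn p 'C(n.*2, n) = 0.
Proof.
move=> pp n4 pn np; apply/eqP; rewrite -leqn0.
apply: leq_trans (@logn_central_bin_leq p n (fun=> 0) pp _) _; last by rewrite big1.
move=> [|[|k]] // _; rewrite addn0.
  have -> : n %/ p ^ 1 = 1 by apply/eqP; rewrite eqn_leq; apply/andP; split; nia.
  by rewrite -ltnS ltn_divLR; lia.
rewrite divn_small //; apply: (@leq_trans (p ^ 2)); last by rewrite leq_pexp2l ?prime_gt0.
nia.
Qed.

Lemma central_bin_leq n s : 4 < n -> s <= n.*2 < s.+1 ^ 2 ->
  'C(n.*2, n) <= n.*2 ^ s * primorial (n.*2 %/ 3)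
                 * n.*2 ^ #|[set p : 'I_(2 * n) | prime p && (n < p)]|.
Proof.
move=> n4 /andP[sN Ns]; set P := #|_|; set N := n.*2; set B := 'C(N, n).
have N0 : 0 < N by rewrite /N; lia.
have B0 : 0 < B by rewrite bin_gt0 /N; lia.
have lognB p : prime p -> p ^ logn p B <= N.
  by move=> pp; apply: expn_logn_central_bin_leq => //; lia.
(* A prime p > N has exponent 0 in B, since otherwise p <= p ^ logn p B <= N. *)
have -> : B = \prod_(0 <= p < N.+1) p ^ logn p B.
  rewrite -[LHS]partnT // (@widen_partn (B + N)) ?leq_addr //=.
  rewrite (@big_cat_nat _ _ _ N.+1) //= ?ltnS ?leq_addl //.
  rewrite [X in _ * X]big_nat [X in _ * X]big1 ?muln1 // => p /andP[Np _].
  have [pp|/negbTE pp] := boolP (prime p); last by rewrite lognE pp.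
  case: (posnP (logn p B)) => [-> //|l0].
  have := lognB p pp; rewrite leqNgt (leq_trans Np) //.
  by rewrite -{1}[p]expn1 leq_exp2l ?prime_gt1.
(* Termwise majorants: [a] for p <= s, [b] for s < p <= 2n/3, [c] for p > n. Letting [a] ignore
   primality and [b] include the primes up to s gives products in closed form. *)
pose a p := if 0 < p <= s then N else 1.
pose b p := if prime p && (p <= N %/ 3) then p else 1.
pose c p := if prime p && (n < p) then N else 1.
have aE : \prod_(0 <= p < N.+1) a p = N ^ s.
  have -> m : \prod_(0 <= p < m.+1) a p = N ^ minn m s.
    elim: m => [|m IHm]; first by rewrite big_nat1 min0n.
    rewrite big_nat_recr // IHm /a /=; case: (leqP m.+1 s) => ms.
      by rewrite -expnSr; congr (_ ^ _); lia.
    by rewrite muln1; congr (_ ^ _); lia.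
  by congr (_ ^ _); lia.
have bE : \prod_(0 <= p < N.+1) b p = primorial (N %/ 3).
  rewrite (@big_cat_nat _ _ _ (N %/ 3).+1) //= ?ltnS ?leq_div //.
  rewrite [X in _ * X]big_nat [X in _ * X]big1 ?muln1 => [|p /andP[Np _]].
    rewrite /primorial [RHS]big_mkcond !big_nat; apply: eq_bigr => p /andP[_ pN].
    by rewrite /b -ltnS pN andbT.
  by rewrite /b leqNgt Np andbF.
have cE : \prod_(0 <= p < N.+1) c p = N ^ P.
  (* The last index N = 2n is even and greater than 2, hence not prime, so the range shrinks to
     'I_(2n). *)
  rewrite big_nat_recr //= {2}/c ifF ?muln1; last first.
    by apply/negbTE/negP => /andP[/even_prime]; rewrite /N; lia.
  rewrite /P mul2n -/N big_mkord -big_mkcond -prod_nat_const.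
  by apply: eq_bigl => p; rewrite inE.
rewrite -aE -bE -cE -!big_split /= !big_nat; apply: leq_prod => p /andP[_ pN].
have a1 : 0 < a p by rewrite /a; case: ifP.
have c1 : 0 < c p by rewrite /c; case: ifP.
have b1 : 0 < b p by rewrite /b; case: ifP => // /andP[/prime_gt0].
have [pp|/negbTE pp] := boolP (prime p); last by rewrite lognE pp !muln_gt0 a1 b1.
have p0 := prime_gt0 pp.
have [ps|sp] := leqP p s.
  apply: leq_trans (lognB p pp) _.
  by rewrite {1}/a p0 ps /= -mulnA leq_pmulr // muln_gt0 b1.
have [np|pn] := ltnP n p.
  by apply: leq_trans (lognB p pp) _; rewrite {1}/c pp np /= leq_pmull // muln_gt0 a1.
have [bp|pb] := leqP p (N %/ 3); last first.
  by rewrite logn_central_bin_medium // ?muln_gt0 ?a1 ?b1 //; lia.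
apply: (@leq_trans p); last first.
  by rewrite mulnAC /b pp bp leq_pmull // muln_gt0 a1.
(* The exponent is below 2, since p ^ logn p B <= N < (s + 1) ^ 2 <= p ^ 2. *)
rewrite -[leqRHS]expn1 leq_exp2l ?prime_gt1 // -ltnS.
rewrite -(ltn_exp2l _ _ (prime_gt1 pp)); apply: leq_ltn_trans (lognB p pp) _.
by apply: leq_trans Ns _; rewrite leq_exp2r.
Qed.

Lemma expn4_leq n s : 4 < n -> s <= n.*2 < s.+1 ^ 2 ->
  4 ^ (n - n.*2 %/ 3) <=
  n.*2 ^ (s.+1 + #|[set p : 'I_(2 * n) | prime p && (n < p)]|).
Proof.
move=> n4 sN; set P := #|_|.
rewrite -(@leq_pmul2r (4 ^ (n.*2 %/ 3))) ?expn_gt0 // -expnD subnK; last lia.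
apply: leq_trans (central_bin_geq n _) _; first lia.
rewrite expnD expnS -!mulnA leq_pmul2l; last lia.
apply: leq_trans (central_bin_leq n s n4 sN) _.
rewrite -mulnA leq_pmul2l ?expn_gt0 ?double_gt0; last by rewrite (ltn_trans _ n4).
by rewrite mulnC leq_mul2l primorial_leq orbT.
Qed.

Lemma isqrt_ex n : exists s, s ^ 2 <= n < s.+1 ^ 2.
Proof.
elim: n => [|n [s /andP[sn ns]]]; first by exists 0.
have [ns'|sn'] := ltnP n.+1 (s.+1 ^ 2).
  by exists s; rewrite ns' ltnW.
by exists s.+1; rewrite sn' (leq_ltn_trans ns) // ltn_exp2r.
Qed.

Local Open Scope ring_scope.

(** * Numerical estimates for logarithms *)

Lemma ln2_le (R : realType) : ln 2 <= 7 / 10 :> R.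
Proof.
rewrite -[leRHS]expRK ler_ln ?posrE ?expR_gt0 //.
have x0 : 0 <= 7 / 10 :> R by lra.
(* 1 + x + x^2/2 + x^3/6 > 2 at x = 7/10 *)
apply: le_trans (@nondecreasing_cvgn_le R (series (exp_coeff (7 / 10))) _ _ 4%N).
- by rewrite /series /= big_mkord !big_ord_recr big_ord0 /exp_coeff /= ?factS ?fact0; lra.
- apply/nondecreasing_seqP => k; rewrite -subr_ge0 seriesSB.
  exact: exp_coeff_ge0.
- exact: is_cvg_series_exp_coeff.
Qed.

Lemma ln_le_sqrt (R : realType) (x : R) : 0 < x ->
  ln x <= 5 + Num.sqrt x / 16.
Proof.
move=> x0; set y := Num.sqrt x.
(* ln x = 2 (5 ln 2 + ln (y / 32)), and 32 is close to the square root of 1100. *)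
have y0 : 0 < y by rewrite sqrtr_gt0.
have -> : x = (2 ^+ 5 * (y / 2 ^+ 5)) ^+ 2.
  by rewrite mulrC divfK ?sqr_sqrtr ?ltW // expf_neq0.
have z0 : 0 < y / 2 ^+ 5 by rewrite divr_gt0 // exprn_gt0.
rewrite lnXn ?mulr_gt0 // ?exprn_gt0 // lnM ?posrE ?exprn_gt0 // lnXn //.
rewrite -[leLHS]mulr_natr -[_ *+ 5]mulr_natr.
(* The bound ln z <= z - 1 at z = y / 32, with ln 2 <= 7/10, gives 10 * 7/10 + 2 (y / 32 - 1) = 5 +
   y / 16. *)
have := @le_ln1Dx R (y / 2 ^+ 5 - 1); rewrite [1 + _]addrC subrK => /(_ ltac:(lra)).
have := ln2_le R.
lra.
Qed.

Lemma isqrt_ln_le (R : realType) (n s : nat) :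
  (1100 <= n)%N -> (s ^ 2 <= 2 * n)%N ->
  s.+1%:R * ln n%:R <= n%:R * (constC R - 4 / 3 * ln 2).
Proof.
move=> hn hs; set x : R := n%:R; set y := Num.sqrt x.
have x1100 : 1100 <= x by rewrite (ler_nat R 1100).
have yE : y ^+ 2 = x by rewrite sqr_sqrtr //; lra.
have y0 : 0 <= y by exact: sqrtr_ge0.
have y33 : 33 + 1 / 10 <= y by nra.
have sE : s%:R ^+ 2 <= 2 * x.
  by rewrite -natrX -[2]/(2%:R) -natrM ler_nat.
have s0 : 0 <= s%:R :> R by [].
(* The fraction 99/70 lies just above the square root of 2. *)
have sy : s%:R <= 99 / 70 * y by nra.
have L : ln x <= 5 + y / 16 by apply: ln_le_sqrt; lra.
have L0 : 0 <= ln x by apply: ln_ge0; lra.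
have D := ln2_le R.
(* From ln 2 <= 7/10, the right side is at least 1.25506 - 14/15 = 0.32172... *)
have C : 3217 / (10 * 10 ^+ 3) <= constC R - 4 / 3 * ln 2 by rewrite /constC; lra.
rewrite -natr1.
apply: (@le_trans _ _ (x * (3217 / (10 * 10 ^+ 3)))); last by rewrite ler_wpM2l //; lra.
apply: (@le_trans _ _ ((99 / 70 * y + 1) * (5 + y / 16))).
  by apply: ler_pM => //; lra.
(* A quadratic inequality in y whose larger root is below 32, while y >= 33.1. *)
rewrite -yE; nra.
Qed.

(** * Passage to logarithms and comparison with the claimed bound *)

Theorem theorem4 (R : realType) (n : nat) (hn : (1100 <= n)%N) :
  Num.floor (n%:R / ln n%:R *
    (ln 4 - constC R - ln 2 * ln 4 / ln (2 * n%:R)))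
  <= #|[set p : 'I_(2 * n) | prime p && (n < p)%N]|%:Z.
Proof.
have [s /andP[sN Ns]] := isqrt_ex (2 * n).
have := isqrt_ln_le R n s hn sN.
have := expn4_leq n s; rewrite -mul2n Ns.
have -> : (s <= 2 * n)%N by apply: leq_trans sN; rewrite -mulnn leq_pmull; lia.
move=> /(_ ltac:(lia) isT).
set P := #|_|; set x : R := n%:R; set D : R := ln 2; set L := ln x.
have x1 : 1 < x by rewrite (ltr_nat R 1); lia.
have D0 : 0 < D by apply: ln_gt0; lra.
have L0 : 0 < L by exact: ln_gt0.
have ln4 : ln 4 = 2 * D :> R.
  by rewrite (_ : 4 = 2 ^+ 2); [rewrite lnXn // mulr_natl | ring].
rewrite ln4; have -> : ln (2 * x) = D + L by rewrite lnM ?posrE //; lra.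
rewrite -(ler_nat R) !natrX natrM -/x => le_pow le_s.
have {le_pow} : (n - (2 * n) %/ 3)%N%:R * (2 * D) <= (s.+1 + P)%N%:R * (D + L).
  have pos4 : 0 < 4%:R :> R by [].
  have posx : 0 < 2 * x by lra.
  rewrite -ler_ln ?posrE ?exprn_gt0 // !lnXn // in le_pow.
  rewrite -[ln 4%:R]/(ln 4) ln4 lnM ?posrE // in le_pow; last lra.
  by rewrite [leLHS]mulr_natl [leRHS]mulr_natl.
have x3 : x / 3 <= (n - (2 * n) %/ 3)%N%:R.
  by rewrite ler_pdivrMr // -[3]/(3%:R) -natrM ler_nat; lia.
rewrite natrD => le_P.
rewrite -(ler_int R) (le_trans (floor_le _)) //=.
have -> : x / L * (2 * D - constC R - D * (2 * D) / (D + L)) =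
    (2 * D * x * L - x * constC R * (D + L)) / (L * (D + L)).
  by field; rewrite !gt_eqF //; lra.
rewrite ler_pdivrMr; last by rewrite mulr_gt0 //; lra.
have h1 : x / 3 * (2 * D) * L <= (s.+1%:R + P%:R) * (D + L) * L.
  rewrite (ler_wpM2r (ltW L0)) //; apply: le_trans le_P.
  by rewrite ler_wpM2r //; lra.
have h2 : s.+1%:R * L * (D + L) <= x * (constC R - 4 / 3 * D) * (D + L).
  by rewrite ler_wpM2r //; lra.
(* Combining [h1] and [h2] yields the goal with a surplus of (4/3) x D ^ 2, which [h3] shows to be
   nonnegative. *)
have h3 : 0 <= x * D * D by rewrite !mulr_ge0 //; lra.
move: h1 h2 h3; rewrite -[_%:~R]/(P%:R : R); move: (constC R) (s.+1%:R) => c t.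
lra.
Qed.
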